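(* Let $p \in [1, +\infty]$ with $p \neq 2$. Then $C_{T_a}$ is unbounded on $h^p$ for all $a \in \mathbb{D}\setminus\{0\}$. Moreover, for every sequence $\beta = (\beta_n)_{n\geq 0}$ of positive numbers satisfying $\liminf_{n\to\infty} \beta_n^{1/n} \geq 1$ and every $a \in \mathbb{D}\setminus\{0\}$, the operator $C_{T_a}$ is not bounded on $h^p(\beta)$.
   Context: $\mathbb{D}$ is the open unit disk of $\mathbb{C}$. Let $\beta = (\beta_n)_{n\geq 0}$ be a sequence of positive numbers with $\liminf_{n\to\infty}\beta_n^{1/n}\geq 1$. For $1 \leq p < \infty$, $h^p(\beta)$ is the Banach space of analytic functions $f(z) = \sum_{n=0}^\infty a_n z^n$ on $\mathbb{D}$ such that $\|f\|_\beta^p := \sum_{n=0}^\infty |a_n|^p \beta_n < +\infty$; for $p = \infty$, $h^\infty(\beta)$ is the space of such functions with $\|f\|_\infty := \sup_{n\geq 0} |a_n|\,\beta_n < +\infty$. For $\beta \equiv 1$ one writes $h^p$. For $a\in\mathbb{D}$, $T_a(z) = \frac{a+z}{1+\bar a z}$ is an automorphism of $\mathbb{D}$, and $C_{T_a}(f) = f\circ T_a$. ''$C_{T_a}$ is bounded on $h^p(\beta)$'' means that it maps $h^p(\beta)$ into itself and is a bounded operator there; unbounded means not bounded. *)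

(* Defs.v *)
From HB Require Import structures.
From mathcomp Require Import all_boot all_order all_algebra.
From mathcomp Require Import complex.
From mathcomp Require Import all_classical all_reals all_analysis.

Set Implicit Arguments.
Unset Strict Implicit.
Unset Printing Implicit Defensive.

Import Order.TTheory GRing.Theory Num.Theory numFieldNormedType.Exports.

Local Open Scope classical_set_scope.
Local Open Scope ring_scope.
Local Open Scope complex_scope.

(* A function on the open unit disk is represented by a total function
   R[i] -> R[i]; everything below depends on its values in the disk only.
   R[i]^o is R[i] with the topology given by its modulus. *)

Definition unit_disk (R : realType) : set R[i] := [set z | `|z| < 1].

Definition power_series_on_disk (R : realType) (f : R[i] -> R[i])
    (a : nat -> R[i]) : Prop :=
  forall z : R[i], unit_disk z ->
    series (fun n => a n * z ^+ n : R[i]^o) @ \oo --> (f z : R[i]^o).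

Definition analytic_on_disk (R : realType) (f : R[i] -> R[i]) : Prop :=
  exists a : nat -> R[i], power_series_on_disk f a.

(* For f analytic on the disk, the set below has exactly one element; the
   default value is only used for other functions. *)
Definition taylor_coef (R : realType) (f : R[i] -> R[i]) : nat -> R[i] :=
  xget (fun=> 0) [set a | power_series_on_disk f a].

(* The value at p = -oo is a dummy. *)
Definition seq_norm (R : realType) (p : \bar R) (beta : nat -> R)
    (a : nat -> R[i]) : \bar R :=
  (match p with
   | r%:E => (\sum_(0 <= n <oo) ((Normc.normc (a n) `^ r)%R * beta n)%:E)
               `^ r^-1
   | +oo => ereal_sup (range (fun n => (Normc.normc (a n) * beta n)%:E))
   | -oo => 0
   end)%E.

Definition h_norm (R : realType) (p : \bar R) (beta : nat -> R)
    (f : R[i] -> R[i]) : \bar R :=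
  seq_norm p beta (taylor_coef f).

Definition h_space (R : realType) (p : \bar R) (beta : nat -> R) :
    set (R[i] -> R[i]) :=
  [set f | analytic_on_disk f /\ (h_norm p beta f < +oo)%E].

Definition bounded_on_h (R : realType) (p : \bar R) (beta : nat -> R)
    (C : (R[i] -> R[i]) -> (R[i] -> R[i])) : Prop :=
  (forall f, h_space p beta f -> h_space p beta (C f)) /\
  exists M : R, forall f, h_space p beta f ->
    (h_norm p beta (C f) <= M%:E * h_norm p beta f)%E.

(* beta n > 0, and liminf (beta n)^(1/n) >= 1 with the liminf taken in the
   extended reals; the n = 0 term is 1 and plays no role. *)
Definition admissible_weight (R : realType) (beta : nat -> R) : Prop :=
  (forall n, 0 < beta n) /\
  (1 <= limn_einf (fun n => (beta n `^ n%:R^-1)%:E))%E.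

Definition disk_aut (R : realType) (a z : R[i]) : R[i] :=
  (a + z) / (1 + conjc a * z).

Definition comp_op (R : realType) (phi : R[i] -> R[i])
    (f : R[i] -> R[i]) : R[i] -> R[i] :=
  f \o phi.

(* Main.v *)
(* Write r = |a|. Up to unimodular factors the matrix of C_{T_a} in the monomial
   basis has entries c n k, the coefficient of z^n in ((r - z) / (1 - r z))^k.
   Since T_a is inner, sum_n (c n k)^2 = 1; moreover n (c n k) = k (c k n).

   If C_{T_a} is bounded on h^p(beta), testing on monomials when p < 2, and on
   extremal polynomials for the dual exponent when p > 2, yields q in [1, 2) and
   weights w > 0 such that sum_n |c n k|^q w n <= M w k for all k, or the same
   for the transposed matrix. By AM-GM (Schur's test), the weights drop out of
   the symmetric sum over a block I x I of |c n k * c k n|^(q/2), which is thus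
   at most M |I|, whatever w is. Over I = [N, C N] the same sum with q = 2 is
   bounded below by a multiple of |I|, since the mass of the k-th column is
   concentrated on n comparable to k; and c n k tends to 0 uniformly on I x I as
   N grows, so that q < 2 makes the block sum much larger than |I|. *)

Require Import Defs.
From HB Require Import structures.
From mathcomp Require Import all_boot all_order all_algebra.
From mathcomp Require Import complex ring lra zify.
From mathcomp Require Import all_classical all_reals all_analysis.

Import Order.TTheory GRing.Theory Num.Theory numFieldNormedType.Exports.

Local Open Scope ring_scope.
Local Open Scope complex_scope.

Set Implicit Arguments.
Unset Strict Implicit.
Unset Printing Implicit Defensive.

(** * Taylor coefficients of the powers of a real disk automorphism *)

(** The recursion is [(1 - r z) g = (r - z) f] read on coefficients. *)
Fixpoint mul_blaschke (R : realType) (r : R) (f : nat -> R) (n : nat) : R :=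
  if n is m.+1 then r * f n - f m + r * mul_blaschke r f m else r * f 0%N.

(* The coefficient of [z ^ n] in [((r - z) / (1 - r z)) ^ k]; multiplication by
   [(r - z) / (1 - r z)] acts on coefficient sequences by [mul_blaschke]. *)
Definition blaschke_coef (R : realType) (r : R) (n k : nat) : R :=
  iter k (mul_blaschke r) (fun n => (n == 0%N)%:R) n.

Arguments blaschke_coef : simpl never.

Section BlaschkeCoef.
Variables (R : realType) (r : R).
Implicit Types n k m j : nat.

Local Notation c := (blaschke_coef r).

Lemma blaschke_coefSS n k : c n.+1 k.+1 = r * c n.+1 k - c n k + r * c n k.+1.
Proof. by []. Qed.

Lemma blaschke_coef0 k : c 0 k = r ^+ k.
Proof. by elim: k => [//|k IH]; rewrite exprS -IH. Qed.

Lemma blaschke_coefS0 n : c n.+1 0 = 0.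
Proof. by []. Qed.

Lemma blaschke_coefS1 n : c n.+1 1 = - (1 - r ^+ 2) * r ^+ n.
Proof.
elim: n => [|n IH].
  by rewrite blaschke_coefSS blaschke_coefS0 !blaschke_coef0; ring.
by rewrite blaschke_coefSS !blaschke_coefS0 IH (exprS r n); ring.
Qed.

(** The recurrence is invariant under transposition when [h] is symmetric, and it determines the
    array from its first row and column. *)
Lemma sym_array (x h : nat -> nat -> R) :
  (forall n k, x n.+1 k.+1 = r * x n.+1 k + r * x n k.+1 - x n k + h n k) ->
  (forall n k, h n k = h k n) -> (forall n, x n 0%N = x 0%N n) ->
  forall n k, x n k = x k n.
Proof.
move=> xE hC x0; elim=> [|n IHn] k; first by rewrite x0.
elim: k => [|k IHk]; first by rewrite x0.
rewrite !xE IHk IHn (IHn k) hC; ring.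
Qed.

(* (1 - r ^+ 2) times the coefficients of ((r - z) / (1 - r z)) ^ k / (1 - r z) *)
Let g n k := c n k - r * c n k.+1.

Let gSS n k : g n.+1 k.+1 = r * g n.+1 k + r * g n k.+1 - g n k.
Proof. by rewrite /g !blaschke_coefSS; ring. Qed.

(** The generating function of [g] in [z] and [w] is [(1 - r^2) / (1 - r z - r w + z w)], which is
    symmetric. *)
Let gC n k : g n k = g k n.
Proof.
apply: (@sym_array g (fun _ _ => 0)) => // [n' k'|n'].
  by rewrite gSS addr0.
rewrite /g !blaschke_coef0 (exprS r n'); case: n' => [|n'].
  by rewrite !blaschke_coef0; ring.
rewrite blaschke_coefS0 blaschke_coefS1 (exprS r n'). ring.
Qed.

(** With [T = (r - z) / (1 - r z)], the array [n * c n k] has generating function [z w T' / (1 - w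
    T)^2 = - (1 - r^2) z w / (1 - r z - r w + z w)^2], again symmetric. Its recurrence has source
    [- g]. *)
Lemma blaschke_coef_sym n k : n%:R * c n k = k%:R * c k n.
Proof.
apply: (@sym_array (fun n k => n%:R * c n k) (fun n k => - g n k)) => [n' k'|n' k'|n'].
- by rewrite /g !blaschke_coefSS -!natr1; ring.
- by rewrite gC.
- by case: n' => [|n']; rewrite ?blaschke_coefS0; ring.
Qed.

Let g_c n k : g n.+1 k - r * g n k = (1 - r ^+ 2) * c n.+1 k.
Proof. by rewrite /g !blaschke_coefSS; ring. Qed.

(** This is [(r - z) f' = - k (1 - r^2) f / (1 - r z)] for [f = T ^ k]. *)
Let b_g n k : r * (n.+1%:R * c n.+1 k) - n%:R * c n k = - k%:R * g n k.
Proof.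
elim: k n => [|k IHk] n.
  by rewrite blaschke_coefS0; case: n => [|n]; rewrite ?blaschke_coefS0; ring.
(* In terms of series, [(1 - r z) (T ^ (k + 1))' = - (k + 1) (1 - r^2) T ^ k / (1 - r z)], deduced
   from the case [k]. *)
have star j : j.+1%:R * c j.+1 k.+1 - r * (j%:R * c j k.+1) = - k.+1%:R * g j k.
  have -> : - k.+1%:R * g j k = - k%:R * g j k - g j k by rewrite -!natr1; ring.
  by rewrite -IHk /g !blaschke_coefSS -!natr1; ring.
elim: n => [|n IHn].
  have := star 0%N; rewrite !mul0r mulr0 !subr0 => ->.
  by rewrite /g !blaschke_coef0 !exprS; ring.
have E1 := star n.+1; have E2 := star n; have E3 := gSS n k.
have F1 : n.+2%:R * c n.+2 k.+1 = r * (n.+1%:R * c n.+1 k.+1) - k.+1%:R * g n.+1 k.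
  by rewrite -[LHS](subrK (r * (n.+1%:R * c n.+1 k.+1))) E1; ring.
have F2 : n.+1%:R * c n.+1 k.+1 = r * (n%:R * c n k.+1) - k.+1%:R * g n k.
  by rewrite -[LHS](subrK (r * (n%:R * c n k.+1))) E2; ring.
have F3 : n%:R * c n k.+1 = r * (n.+1%:R * c n.+1 k.+1) + k.+1%:R * g n k.+1.
  by rewrite -[LHS](subKr (r * (n.+1%:R * c n.+1 k.+1))) IHn; ring.
rewrite F1 E3 {2}F2 F3; ring.
Qed.

(* The differential equation (1 - r z) (r - z) f' = - k (1 - r ^+ 2) f,
   read on coefficients. *)
Lemma blaschke_coef_rec n k :
  r * (n.+2%:R * c n.+2 k + n%:R * c n k) =
  (1 + r ^+ 2) * (n.+1%:R * c n.+1 k) - k%:R * (1 - r ^+ 2) * c n.+1 k.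
Proof.
have E1 := b_g n.+1 k; have E2 := b_g n k; have E3 := g_c n k.
have -> : k%:R * (1 - r ^+ 2) * c n.+1 k = k%:R * g n.+1 k - r * (k%:R * g n k).
  by rewrite -mulrA -E3; ring.
have -> : k%:R * g n.+1 k = n.+1%:R * c n.+1 k - r * (n.+2%:R * c n.+2 k).
  by rewrite -[LHS]opprK -mulNr -E1; ring.
have -> : k%:R * g n k = n%:R * c n k - r * (n.+1%:R * c n.+1 k).
  by rewrite -[LHS]opprK -mulNr -E2; ring.
ring.
Qed.

(** Multiplication by the inner function [T] preserves the [l^2] norm; truncation at [m] leaves a
    single square as defect. *)
Lemma sum_sqr_blaschke_coefS m k :
  (1 - r ^+ 2) * \sum_(n < m) c n k.+1 ^+ 2 =
  (1 - r ^+ 2) * \sum_(n < m) c n k ^+ 2 - (c m k.+1 - r * c m k) ^+ 2.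
Proof.
elim: m => [|m IH]; first by rewrite !big_ord0 !blaschke_coef0 (exprS r k); ring.
by rewrite !big_ord_recr !mulrDr IH /= blaschke_coefSS; ring.
Qed.

Hypotheses (r_gt0 : 0 < r) (r_lt1 : r < 1).

Let r2_gt0 : 0 < 1 - r ^+ 2.
Proof. by rewrite subr_gt0 expr_lt1 // ltW. Qed.

Lemma sum_sqr_blaschke_coef_le1 m k : \sum_(n < m) c n k ^+ 2 <= 1.
Proof.
elim: k => [|k IH].
  case: m => [|m]; first by rewrite big_ord0.
  by rewrite big_ord_recl big1 ?addr0 ?expr1n // => i _; rewrite blaschke_coefS0 expr0n.
apply: le_trans IH; rewrite -(ler_pM2l r2_gt0) sum_sqr_blaschke_coefS.
by rewrite gerBl sqr_ge0.
Qed.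

Lemma blaschke_coef_le1 n k : `|c n k| <= 1.
Proof.
rewrite -(@expr_le1 _ 2) // real_normK ?num_real //.
apply: le_trans (sum_sqr_blaschke_coef_le1 n.+1 k).
by rewrite big_ord_recr lerDr sumr_ge0 // => i _; apply: sqr_ge0.
Qed.

End BlaschkeCoef.

(** * Exponential tails and concentration of the columns *)

Lemma natr_mul_expr_le (R : realFieldType) (s : R) (k : nat) :
  0 < s < 1 -> k%:R * s ^+ k <= (1 - s)^-1.
Proof.
move=> /andP[s0 s1]; have s1' : 0 < 1 - s by rewrite subr_gt0.
(* [1 - s ^+ k] is [1 - s] times a sum of [k] powers of [s], each at least [s ^+ k]. *)
suff H : k%:R * (1 - s) * s ^+ k <= 1 - s ^+ k.
  rewrite -[X in _ <= X]mul1r ler_pdivlMr // mulrAC; apply: le_trans H _.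
  by rewrite gerBl exprn_ge0 // ltW.
elim: k => [|k IH]; first by rewrite mul0r mul0r expr0 subrr.
have p1 : s ^+ k <= 1 by rewrite exprn_ile1 // ltW.
have p0 : 0 <= s ^+ k by rewrite exprn_ge0 // ltW.
rewrite -natr1 (exprS s k); move: (s ^+ k) p0 p1 IH => x p0 p1 IH.
have := ler_wpM2l (ltW s0) IH; have : 0 <= (1 - s) * (1 - s * x).
  by apply: mulr_ge0; rewrite ?subr_ge0 ?(ltW s1) //; nra.
move: (k%:R) => y; nra.
Qed.

Lemma expr_small (R : realType) (s e : R) :
  0 < s < 1 -> 0 < e -> exists N : nat, forall n, (N <= n)%N -> s ^+ n <= e.
Proof.
move=> s01 e0; have /andP[s0 s1] := s01.
have d0 : 0 < 1 - s by rewrite subr_gt0.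
exists (Num.bound ((1 - s)^-1 / e)).+1 => n len.
have n0 : 0 < n%:R :> R by rewrite ltr0n; lia.
have := natr_mul_expr_le n s01.
rewrite mulrC -ler_pdivlMr // => /le_trans; apply.
rewrite ler_pdivrMr // mulrC -ler_pdivrMr //.
have /archi_boundP/ltW/le_trans : 0 <= (1 - s)^-1 / e.
  by rewrite divr_ge0 ?invr_ge0 // ltW.
by apply; rewrite ler_nat; lia.
Qed.

Section BlaschkeTails.
Variables (R : realType) (r : R).
Hypotheses (r_gt0 : 0 < r) (r_lt1 : r < 1).

Local Notation c := (blaschke_coef r).

(** Cauchy's estimate on the circle [|z| = 1 / s], where [|T| <= (r s + 1) / (s - r) <= Q]; the
    recurrence replaces the contour integral. *)
Lemma blaschke_coef_geo (s Q : R) (n k : nat) :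
  r < s -> 1 <= Q -> r * s + 1 <= (s - r) * Q -> `|c n k| <= s ^+ n * Q ^+ k.
Proof.
move=> rs Q1 sQ; have s0 : 0 < s by apply: lt_trans rs.
have Q0 : 0 < Q by apply: lt_le_trans Q1.
elim: k n => [|k IHk] n.
  case: n => [|n]; first by rewrite blaschke_coef0 !expr0 normr1 mulr1.
  by rewrite blaschke_coefS0 normr0 expr0 mulr1 exprn_ge0 // ltW.
elim: n => [|n IHn].
  rewrite blaschke_coef0 expr0 mul1r ger0_norm ?exprn_ge0 ?(ltW r_gt0) //.
  rewrite lerXn2r ?nnegrE ?(ltW r_gt0) ?(ltW Q0) //.
  by apply: le_trans Q1; apply: ltW.
rewrite blaschke_coefSS.
apply: (le_trans (ler_normD _ _)); rewrite normrM (gtr0_norm r_gt0).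
have H1 : `|r * c n.+1 k - c n k| <= r * `|c n.+1 k| + `|c n k|.
  by apply: (le_trans (ler_normB _ _)); rewrite normrM (gtr0_norm r_gt0).
apply: (le_trans (lerD H1 (ler_wpM2l (ltW r_gt0) IHn))).
apply: (le_trans (lerD (lerD (ler_wpM2l (ltW r_gt0) (IHk n.+1)) (IHk n)) (lexx _))).
have p : 0 <= s ^+ n * Q ^+ k by rewrite mulr_ge0 ?exprn_ge0 // ltW.
have -> : s ^+ n.+1 * Q ^+ k.+1 = (s ^+ n * Q ^+ k) * (s * Q) by rewrite !exprS; ring.
have -> : r * (s ^+ n.+1 * Q ^+ k) + s ^+ n * Q ^+ k + r * (s ^+ n * Q ^+ k.+1)
   = (s ^+ n * Q ^+ k) * (r * s + 1 + r * Q) by rewrite !exprS; ring.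
by apply: ler_wpM2l => //; nra.
Qed.

(* [T ^ k] is analytic beyond the unit circle, so its coefficients of index
   [n >= L k] are exponentially small; those of index [n < k / L] are small by
   the symmetry [blaschke_coef_sym]. *)
Lemma blaschke_coef_window : exists L K0 : nat, (0 < L)%N /\
  forall k, (K0 <= k)%N ->
    2^-1 <= \sum_(n < L * k | (k <= L * n)%N) c n k ^+ 2.
Proof.
have r0 := r_gt0; have r1 := r_lt1.
(* Taking [s = t ^+ 4] leaves room: three factors [t ^+ k] absorb [k ^ 3] and the fourth still
   decays. *)
have [t [t0 t1 rt]] : exists t, [/\ 0 < t, t < 1 & r < t ^+ 4].
  exists (1 - (1 - r) / 8); split; [lra | lra |].
  set y := (1 - r) / 8; have /andP[y0 y1] : 0 < y < 1 by rewrite /y; lra.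
  have : 1 - 2 * y <= (1 - y) ^+ 2 by nra.
  rewrite (exprM _ 2 2); have : r = 1 - 8 * y by rewrite /y; lra.
  by move: ((1 - y) ^+ 2) => w; nra.
have [s sE] : exists s, s = t ^+ 4 by exists (t ^+ 4).
pose Q := (r * s + 1) / (s - r).
have t01 : 0 < t < 1 by rewrite t0.
have rs : r < s by rewrite sE.
have s1 : s < 1 by rewrite sE expr_lt1 // ltW.
have s0 : 0 < s by lra.
have s01 : 0 < s < 1 by rewrite s0.
have sr0 : 0 < s - r by lra.
have QE : r * s + 1 = (s - r) * Q by rewrite /Q [RHS]mulrC divfK // gt_eqF.
have Q1 : 1 <= Q.
  by rewrite /Q ler_pdivlMr // mul1r; have := mulr_gt0 r_gt0 s0; lra.
have Q0 : 0 < Q by apply: lt_le_trans Q1.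
have geo n k : `|c n k| <= s ^+ n * Q ^+ k by apply: blaschke_coef_geo => //; rewrite QE.
have geo2 n k : c n k ^+ 2 <= s ^+ n * (s ^+ n * (Q ^+ 2) ^+ k).
  have -> : s ^+ n * (s ^+ n * (Q ^+ 2) ^+ k) = (s ^+ n * Q ^+ k) ^+ 2.
    by rewrite (exprAC Q); ring.
  rewrite -real_normK ?num_real // lerXn2r ?nnegrE ?normr_ge0 //.
  by rewrite mulr_ge0 ?exprn_ge0 // ltW.
have Q2 : 0 < Q ^- 2 by rewrite invr_gt0 exprn_gt0.
have [L0 HL0] := expr_small s01 Q2.
(* From [n = L k] on, one of the two factors [s ^+ n] in [geo2] absorbs [(Q ^+ 2) ^+ k]; the other
   one is the decay. *)
pose L := L0.+1.
have HL k : s ^+ (L * k) * (Q ^+ 2) ^+ k <= 1.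
  rewrite exprM -exprMn; apply: exprn_ile1.
    rewrite mulr_ge0 ?exprn_ge0 ?(ltW s0) ?(ltW Q0) //.
  by rewrite -ler_pdivlMr ?exprn_gt0 // mul1r HL0.
have smono m n : (m <= n)%N -> s ^+ n <= s ^+ m.
  by move=> mn; rewrite ler_wiXn2l // ltW.
have HL' m k : (L * k <= m)%N -> s ^+ m * (Q ^+ 2) ^+ k <= 1.
  move=> /smono/ler_wpM2r; move/(_ ((Q ^+ 2) ^+ k)).
  by rewrite !exprn_ge0 ?(ltW Q0) // => /(_ isT)/le_trans; apply.
have high n k : (L * k <= n)%N -> c n k ^+ 2 <= s ^+ n.
  move=> h; apply: (le_trans (geo2 n k)).
  by rewrite -[X in _ <= X]mulr1 ler_wpM2l ?exprn_ge0 ?(ltW s0) ?HL'.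
have low n k : (0 < k)%N -> (L * n < k)%N -> c n k ^+ 2 <= k%:R ^+ 2 * s ^+ k.
  move=> k0 nk; have k1 : 1 <= k%:R ^+ 2 :> R by rewrite exprn_ege1 // ler1n.
  (* The symmetry says nothing at [n = 0], but there the coefficient is [r ^+ k]. *)
  case: n nk => [|n] nk.
    rewrite blaschke_coef0 -exprM mulnC exprM.
    apply: (@le_trans _ _ (s ^+ k)).
      by rewrite lerXn2r ?nnegrE ?exprn_ge0 ?(ltW s0) ?(ltW r_gt0) //; nra.
    by rewrite ler_peMl // exprn_ge0 // ltW.
  have n1 : 1 <= n.+1%:R ^+ 2 :> R by rewrite exprn_ege1 // ler1n.
  have := blaschke_coef_sym r n.+1 k => /(congr1 (fun x => x ^+ 2)); rewrite !exprMn => E.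
  apply: (@le_trans _ _ (n.+1%:R ^+ 2 * c n.+1 k ^+ 2)); first by rewrite ler_peMl // sqr_ge0.
  by rewrite E ler_wpM2l ?sqr_ge0 // high // ltnW.
pose B := (1 - t)^-1; have B0 : 0 < B by rewrite invr_gt0; lra.
have tk k : k%:R * t ^+ k <= B by apply: natr_mul_expr_le.
have tk0 k : 0 <= k%:R * t ^+ k by rewrite mulr_ge0 // exprn_ge0 // ltW.
have t_le1 k : 0 <= t ^+ k <= 1 by rewrite exprn_ge0 ?exprn_ile1 ?(ltW t0) // ltW.
have d0 : 0 < 1 - r ^+ 2 by rewrite subr_gt0 expr_lt1 // ltW.
(* [D * t ^+ k] bounds the sum of the two losses: the mass beyond [L k] and the mass below
   [k / L]. *)
pose D := 4 * B / (1 - r ^+ 2) + L%:R * B ^+ 3.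
have D0 : 0 < D.
  by apply: addr_gt0; [apply: divr_gt0 => //; apply: mulr_gt0 | apply: mulr_gt0 => //; apply: exprn_gt0].
have D20 : 0 < (2 * D)^-1 by rewrite invr_gt0 mulr_gt0.
have [K0 HK0] := expr_small t01 D20.
exists L, K0.+1; split; first by [].
move=> k kK; have k0 : (0 < k)%N := leq_ltn_trans (leq0n _) kK.
have sk : s ^+ k = (t ^+ k) ^+ 4 by rewrite sE -!exprM mulnC.
have E1 : k%:R * s ^+ k <= B * t ^+ k.
  rewrite sk; have := tk k; have /andP[] := t_le1 k; have := tk0 k.
  move: (t ^+ k) (k%:R) => x y h0 x0 x1 h1.
  have -> : y * x ^+ 4 = (y * x) * x * x ^+ 2 by ring.
  have x21 : 0 <= x ^+ 2 <= 1 by rewrite sqr_ge0 exprn_ile1.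
  have : 0 <= (B - y * x) * x by rewrite mulr_ge0 // subr_ge0.
  have : 0 <= y * x * x by rewrite mulr_ge0.
  by move: (y * x) => z; nra.
have E2 : (L * k)%:R * (k%:R ^+ 2 * s ^+ k) <= L%:R * B ^+ 3 * t ^+ k.
  rewrite natrM sk.
  have -> : L%:R * k%:R * (k%:R ^+ 2 * (t ^+ k) ^+ 4) = L%:R * (k%:R * t ^+ k) ^+ 3 * t ^+ k by ring.
  have /andP[? _] := t_le1 k.
  by rewrite ler_wpM2r // ler_wpM2l // lerXn2r ?nnegrE ?(ltW B0).
(* Each of the [j] multiplications by [T] loses only the square at the cut [L k], which is at most
   [4 * s ^+ k]. *)
have full j : (j <= k)%N ->
    (1 - r ^+ 2) - j%:R * (4 * s ^+ k) <= (1 - r ^+ 2) * \sum_(n < L * k) c n j ^+ 2.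
  elim: j => [_|j IH jk].
    have -> : \sum_(n < L * k) c n 0 ^+ 2 = 1; last by rewrite mulr1 mul0r subr0.
    have : (0 < L * k)%N by rewrite muln_gt0.
    case: (L * k)%N => // m _; rewrite big_ord_recl big1 => [|i _].
      by rewrite addr0 expr1n.
    by rewrite blaschke_coefS0 expr0n.
  rewrite sum_sqr_blaschke_coefS -natr1.
  have := IH (ltnW jk).
  have bnd i : (i <= k)%N -> c (L * k) i ^+ 2 <= s ^+ k.
    move=> ik; apply: (@le_trans _ _ (s ^+ (L * k))); last by apply: smono; rewrite leq_pmull.
    by apply: high; rewrite leq_mul2l ik orbT.
  have := bnd _ jk; have := bnd _ (ltnW jk).
  move: (c _ j) (c _ j.+1) (s ^+ k) (\sum_(n < _) _) (j%:R) => x y w S J.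
  move=> xw yw h.
  suff : (y - r * x) ^+ 2 <= 4 * w by lra.
  have : (y - r * x) ^+ 2 <= 2 * y ^+ 2 + 2 * (r ^+ 2 * x ^+ 2).
    by have := sqr_ge0 (y + r * x); lra.
  have : r ^+ 2 * x ^+ 2 <= x ^+ 2 by rewrite ler_piMl ?sqr_ge0 // exprn_ile1 // ltW.
  lra.
have := full k (leqnn k).
rewrite (bigID (fun n : 'I_(L * k) => (k <= L * n)%N)) /=.
set S1 := \sum_(_ < _ | _) _; set S2 := \sum_(_ < _ | _) _.
have S2le : S2 <= L%:R * B ^+ 3 * t ^+ k.
  apply: le_trans E2; rewrite mulr_natl.
  rewrite -[X in _ *+ X]card_ord -sumr_const [X in _ <= X](bigID (fun n : 'I_(L * k) => (k <= L * n)%N)) /=.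
  rewrite -[S2]add0r; apply: lerD.
    by apply: sumr_ge0 => i _; rewrite mulr_ge0 ?sqr_ge0 ?exprn_ge0 ?(ltW s0).
  by apply: ler_sum => i; rewrite -ltnNge => ?; apply: low.
move=> H.
have : 1 - 4 * (B * t ^+ k) / (1 - r ^+ 2) <= S1 + S2.
  rewrite -(ler_pM2l d0) mulrBr mulr1 [X in _ - X]mulrC divfK ?gt_eqF //.
  lra.
have : D * t ^+ k <= 2^-1.
  have -> : 2^-1 = D * (2 * D)^-1 by field; rewrite gt_eqF.
  by rewrite ler_pM2l // HK0 // ltnW.
by rewrite /D mulrDl; lra.
Qed.
End BlaschkeTails.

(** * Uniform decay of the coefficients *)

(** Chebyshev polynomials of the first kind. The argument may lie outside [[-1, 1]], so identities
    are proved from the recurrence and not from cosines. *)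
Fixpoint cheb (R : realType) (x : R) (n : nat) : R :=
  match n with
  | 0%N => 1
  | 1%N => x
  | (m.+1 as p).+1 => 2 * x * cheb x p - cheb x m
  end.

Lemma chebSS (R : realType) (x : R) n :
  cheb x n.+2 = 2 * x * cheb x n.+1 - cheb x n.
Proof. by []. Qed.

Arguments cheb : simpl never.

Lemma cheb_double (R : realType) (x : R) n :
  cheb x (2 * n) = 2 * cheb x n ^+ 2 - 1.
Proof.
(* The induction also needs the odd index and the quadratic invariant of the recurrence. *)
suff [] : [/\ cheb x (2 * n) = 2 * cheb x n ^+ 2 - 1,
    cheb x (2 * n).+1 = 2 * cheb x n * cheb x n.+1 - x &
    cheb x n.+1 ^+ 2 + cheb x n ^+ 2 - 2 * x * cheb x n * cheb x n.+1 = 1 - x ^+ 2] by [].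
elim: n => [|n [IH1 IH2 IH3]]; first by split; rewrite /cheb /=; ring.
have E1 : cheb x (2 * n.+1) = 2 * cheb x n.+1 ^+ 2 - 1.
  rewrite mulnS chebSS IH1 IH2; move: IH3; lra.
split; first exact: E1.
  have -> : cheb x (2 * n.+1).+1 = 2 * x * cheb x (2 * n.+1) - cheb x (2 * n).+1.
    by rewrite mulnS.
  by rewrite E1 IH2 chebSS; ring.
by rewrite -IH3 chebSS; ring.
Qed.

(** If [|T_n(x)| < 1/2], then [2 T_n(x)^2 - 1 <= -1/2]. *)
Lemma cheb_half (R : realType) (x : R) n :
  2^-1 <= `|cheb x n| \/ 2^-1 <= `|cheb x (2 * n)|.
Proof.
case: (lerP 2^-1 `|cheb x n|) => [|h]; [by left|right].
rewrite cheb_double; have : `|cheb x n| ^+ 2 <= 2^-1 ^+ 2.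
  by rewrite lerXn2r ?nnegrE // ltW.
rewrite real_normK ?num_real // => h2.
by rewrite ler_normr; apply/orP; right; lra.
Qed.

(** A discrete Gronwall estimate: the difference has zero initial values and source at most [e], and
    each step, source included, costs at most a factor [2 * G + 2]. *)
Lemma cheb_perturb (R : realType) (x e G : R) (s : nat -> R) (J : nat) :
  `|x| <= G -> 0 <= e -> s 1%N = x * s 0%N ->
  (forall j, (j.+1 < J)%N -> `|s j.+2 + s j - 2 * x * s j.+1| <= e) ->
  forall j, (j <= J)%N -> `|s j - cheb x j * s 0%N| <= (2 * G + 2) ^+ j * e.
Proof.
move=> xG e0 s1 sJ; have G0 : 0 <= G by apply: le_trans xG.
have p j : 1 <= (2 * G + 2) ^+ j by apply: exprn_ege1; lra.
have p0 j : 0 <= (2 * G + 2) ^+ j := le_trans ler01 (p j).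
suff H j : (j.+1 <= J)%N -> `|s j - cheb x j * s 0%N| <= (2 * G + 2) ^+ j * e /\
    `|s j.+1 - cheb x j.+1 * s 0%N| <= (2 * G + 2) ^+ j.+1 * e.
  case=> [_|j jJ]; last by have [] := H j jJ.
  by rewrite mul1r subrr normr0 mulr_ge0.
elim: j => [_|j IH jJ].
  by rewrite s1 mul1r !subrr !normr0; split; rewrite mulr_ge0.
have [IH1 IH2] := IH (ltnW jJ); split; first exact: IH2.
have -> : s j.+2 - cheb x j.+2 * s 0%N =
   (s j.+2 + s j - 2 * x * s j.+1) + (2 * x * (s j.+1 - cheb x j.+1 * s 0%N)
    - (s j - cheb x j * s 0%N)) by rewrite chebSS; ring.
have pe := p j; have := sJ j jJ.
move: IH1 IH2; set A := s j - _; set B := s j.+1 - _; set E := _ - 2 * x * _.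
move=> IH1 IH2 hE.
apply: (le_trans (ler_normD _ _)).
apply: (le_trans (lerD hE (ler_normB _ _))).
rewrite !normrM normr_nat.
have : `|x| * `|B| <= G * ((2 * G + 2) ^+ j.+1 * e) by apply: ler_pM.
rewrite !exprS; clear IH2.
move: ((2 * G + 2) ^+ j) pe IH1 => P pe IH1.
have ? : 0 <= (P - 1) * e by rewrite mulr_ge0 // subr_ge0.
have ? : 0 <= G * (P * e) by rewrite mulr_ge0 // mulr_ge0 //; lra.
rewrite -(mulrA 2); move: (`|x| * `|B|) => z Hz; nra.
Qed.

Lemma sum_around (R : realType) (F : nat -> R) m K : (K <= m)%N ->
  F m + \sum_(i < K) (F (m + i.+1)%N + F (m - i.+1)%N)
  = \sum_(m - K <= n < (m + K).+1) F n.
Proof.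
elim: K => [|K IH] Km.
  by rewrite big_ord0 addr0 addn0 subn0 big_nat1.
rewrite big_ord_recr addrA IH ?(ltnW Km) //= addnS.
rewrite [RHS]big_nat_recr /=; last by lia.
rewrite [X in _ = X + _]big_ltn; last by lia.
rewrite (_ : (m - K.+1).+1 = m - K)%N; last by lia.
by ring.
Qed.

(** Every index below [2 J] is hit at most twice. With indices shifted by one, these are the pairs
    [i], [2 i] of [cheb_half]. *)
Lemma sum_odd_le (R : realType) (F : nat -> R) J : (forall i, 0 <= F i) ->
  \sum_(j < J) (F j + F (2 * j).+1) <= 2 * \sum_(i < 2 * J) F i.
Proof.
move=> F0; rewrite big_split mulr2n mulrDl mul1r; apply: lerD.
  rewrite mul2n -addnn big_split_ord /= lerDl.
  by apply: sumr_ge0.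
elim: J => [|J IH]; first by rewrite !big_ord0.
by rewrite mulnS !big_ord_recr /= -addrA lerD // lerDr.
Qed.

Section BlaschkeDecay.
Variables (R : realType) (r : R).
Hypotheses (r_gt0 : 0 < r) (r_lt1 : r < 1).

Local Notation c := (blaschke_coef r).

(* Around a fixed index [m] the recurrence [blaschke_coef_rec] has almost
   constant coefficients, so that [b (m + j) + b (m - j)], where
   [b n = n * c n k], is close to [2 T_j(x) b m] with [T_j] the Chebyshev
   polynomial. As [T_j(x)] and [T_2j(x)] cannot both be small, a large [c m k]
   propagates to many neighbours, which contradicts [sum_sqr_blaschke_coef_le1]. *)
Lemma blaschke_coef_decay (C d : R) : 0 < C -> 0 < d ->
  exists N : nat, forall n k, (N <= n)%N -> k%:R <= C * n%:R -> `|c n k| <= d.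
Proof.
move=> C0 d0; have r0 := r_gt0; have r1 := r_lt1.
have r2_gt0 : 0 < 1 - r ^+ 2 by rewrite subr_gt0 expr_lt1 // ltW.
have [kap kapE] : exists kap, kap = (1 - r ^+ 2) / r by eexists.
have kap0 : 0 < kap by rewrite kapE divr_gt0.
pose G := (1 + r ^+ 2) / (2 * r) + C * kap / 2.
have rr0 : 0 < (1 + r ^+ 2) / (2 * r) by rewrite divr_gt0 ?mulr_gt0 // addr_gt0 // exprn_gt0.
have G0 : 0 < G by rewrite addr_gt0 // divr_gt0 // mulr_gt0.
(* [J * (d ^+ 2 / 32)] exceeds [2], twice the largest possible mass of a column. *)
have [J HJ] : exists J : nat, 64 / d ^+ 2 < J%:R.
  by exists (Num.bound (64 / d ^+ 2)); apply: archi_boundP; rewrite divr_ge0 ?sqr_ge0.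
pose e := 2 * (C * kap * (2 * J)%:R).
have e0 : 0 <= e by rewrite mulr_ge0 // mulr_ge0 // ltW // mulr_gt0.
have [D DE] : exists D, D = (2 * G + 2) ^+ (2 * J) * e by eexists.
have D0 : 0 <= D by rewrite DE mulr_ge0 // exprn_ge0 //; lra.
have [N0 HN0] : exists N : nat, 2 * D / d < N%:R.
  exists (Num.bound (2 * D / d)); apply: archi_boundP.
  by rewrite divr_ge0 ?mulr_ge0 ?(ltW d0).
(* [N0] makes the accumulated error [D] at most [m d / 2]; the term [4 * J] keeps [m - 2 J] positive
   and [m + 2 J] at most [2 m]. *)
exists (N0 + 4 * J).+1 => m k mN kC.
rewrite leNgt; apply/negP => dc.
have m0 : 0 < m%:R :> R by rewrite ltr0n; clear -mN; lia.
have mD : D <= m%:R * d / 2.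
  suff : 2 * D / d <= m%:R by rewrite ler_pdivrMr //; lra.
  by apply: (le_trans (ltW HN0)); rewrite ler_nat; clear -mN; lia.
(* [2 * x] is the coefficient of [b n] in the recurrence, frozen at [n = m]. *)
pose x := ((1 + r ^+ 2) - k%:R * (1 - r ^+ 2) / m%:R) / (2 * r).
pose b n := n%:R * c n k.
(* Symmetrising about [m] gives [s 1 = x * s 0], the initial condition of [T_j(x)], and removes the
   second solution of the recurrence. *)
pose s j := b (m + j)%N + b (m - j)%N.
have km : 0 <= k%:R / m%:R :> R /\ k%:R / m%:R <= C by split; [apply: divr_ge0 | rewrite ler_pdivrMr].
have xG : `|x| <= G.
  have -> : x = (1 + r ^+ 2) / (2 * r) - (k%:R / m%:R) * kap / 2.
    by rewrite /x kapE; field; rewrite gt_eqF //= gt_eqF.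
  apply: (le_trans (ler_normB _ _)); rewrite (gtr0_norm rr0) lerD2l.
  have [h1 h2] := km.
  rewrite ger0_norm; last by apply: divr_ge0 => //; apply: mulr_ge0 => //; exact: ltW.
  by rewrite ler_pM2r ?ler_pM2r ?invr_gt0.
have rec n : (0 < n)%N ->
    b n.+1 + b n.-1 - 2 * x * b n = (k%:R / m%:R) * kap * ((n%:R - m%:R) * c n k).
  case: n => // n _; have := blaschke_coef_rec r n k.
  rewrite /b /x kapE /= => /(congr1 (fun y => y / r)); rewrite mulrAC divff ?gt_eqF // mul1r => ->.
  by field; rewrite !gt_eqF.
have sE j : (j.+1 < 2 * J)%N -> `|s j.+2 + s j - 2 * x * s j.+1| <= e.
  move=> jJ.
  have -> : s j.+2 + s j - 2 * x * s j.+1 =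
     (b (m + j.+1).+1 + b (m + j.+1).-1 - 2 * x * b (m + j.+1)%N) +
     (b (m - j.+1).+1 + b (m - j.+1).-1 - 2 * x * b (m - j.+1)%N).
    rewrite /s !addnS (_ : (m - j.+1).+1 = m - j)%N; last by clear -mN jJ; lia.
    rewrite (_ : (m - j.+1).-1 = m - j.+2)%N; last by clear -mN jJ; lia.
    by rewrite /=; ring.
  rewrite !rec; [|clear -mN jJ; lia|clear -mN jJ; lia].
  rewrite natrD natrB; last by clear -mN jJ; lia.
  have [h1 h2] := km.
  have bnd (y z : R) n : `|y| <= 1 -> (n <= 2 * J)%N -> `|z| = n%:R ->
      `|(k%:R / m%:R) * kap * (z * y)| <= C * kap * (2 * J)%:R.
    move=> y1 nJ zn; rewrite !normrM zn (ger0_norm (ltW kap0)).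
    rewrite -[`|k%:R| * `|_|]normrM (ger0_norm h1).
    apply: ler_pM; rewrite ?mulr_ge0 ?(ltW kap0) //; first by rewrite ler_pM2r.
    by rewrite -[X in _ <= X]mulr1; apply: ler_pM; rewrite // ler_nat.
  have -> : e = C * kap * (2 * J)%:R + C * kap * (2 * J)%:R by rewrite /e; ring.
  apply: (le_trans (ler_normD _ _)); apply: lerD.
    apply: (bnd _ _ j.+1); [exact: blaschke_coef_le1 | exact: ltnW |].
    by rewrite addrAC subrr add0r normr_nat.
  apply: (bnd _ _ j.+1); [exact: blaschke_coef_le1 | exact: ltnW |].
  by rewrite addrAC subrr add0r normrN normr_nat.
have s0 : s 0%N = 2 * (m%:R * c m k) by rewrite /s addn0 subn0 /b; ring.
have s1 : s 1%N = x * s 0%N.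
  have := rec m; rewrite subrr mul0r mulr0 => /(_ (leq_ltn_trans (leq0n _) mN)) /eqP.
  by rewrite subr_eq0 s0 /s addn1 subn1 => /eqP ->; rewrite /b; ring.
have pert := cheb_perturb xG e0 s1 sE.
(* The main term is at least [m d] and the error at most [m d / 2]; dividing by [2 m >= m + i]
   returns from [b] to the coefficients. *)
have big_s i : (i <= 2 * J)%N -> 2^-1 <= `|cheb x i| ->
    d ^+ 2 / 32 <= c (m + i) k ^+ 2 + c (m - i) k ^+ 2.
  move=> iJ ti.
  have H1 : `|s i - cheb x i * s 0%N| <= D.
    apply: (le_trans (pert i iJ)); rewrite DE; apply: ler_wpM2r => //.
    by apply: ler_weXn2l => //; lra.
  have H2 : m%:R * d <= `|cheb x i * s 0%N|.
    rewrite s0 !normrM !normr_nat.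
    have : 2^-1 * (m%:R * d) <= `|cheb x i| * (m%:R * `|c m k|).
      by apply: ler_pM => //; [rewrite mulr_ge0 // ltW | rewrite ler_pM2l // ltW].
    lra.
  have H3 : m%:R * d / 2 <= `|s i|.
    have : `|cheb x i * s 0%N| <= `|s i - cheb x i * s 0%N| + `|s i|.
      by rewrite distrC; have := ler_normD (cheb x i * s 0%N - s i) (s i); rewrite subrK.
    lra.
  have H4 : `|s i| <= 2 * m%:R * (`|c (m + i) k| + `|c (m - i) k|).
    rewrite /s /b; apply: (le_trans (ler_normD _ _)); rewrite !normrM !normr_nat mulrDr.
    by apply: lerD; apply: ler_wpM2r => //; rewrite -natrM ler_nat; clear -mN iJ; lia.
  have H5 : d / 4 <= `|c (m + i) k| + `|c (m - i) k|.
    rewrite -(ler_pM2l m0); lra.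
  rewrite -(real_normK (num_real (c (m + i) k))) -(real_normK (num_real (c (m - i) k))).
  move: (`|c (m + i) k|) (`|c (m - i) k|) H5 => u v H5.
  have : 0 <= (u - v) ^+ 2 := sqr_ge0 _.
  have : (d / 4) ^+ 2 <= (u + v) ^+ 2 by rewrite lerXn2r ?nnegrE //; lra.
  lra.
pose F i := c (m + i.+1) k ^+ 2 + c (m - i.+1) k ^+ 2.
have F0 i : 0 <= F i by rewrite addr_ge0 ?sqr_ge0.
have low : J%:R * (d ^+ 2 / 32) <= \sum_(j < J) (F j + F (2 * j).+1).
  rewrite mulr_natl -[X in _ *+ X]card_ord -sumr_const; apply: ler_sum => j _.
  have jJ := ltn_ord j.
  have [h|h] := cheb_half x j.+1.
    by apply: (le_trans (big_s _ _ h)); [clear -jJ; lia | rewrite lerDl].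
  by apply: (le_trans (big_s _ _ h)); [clear -jJ; lia | rewrite mulnS lerDr].
have up : \sum_(i < 2 * J) F i <= 1.
  apply: le_trans (sum_sqr_blaschke_coef_le1 r0 r1 (m + 2 * J).+1 k).
  have /= E := @sum_around _ (fun n => c n k ^+ 2) m (2 * J).
  apply: (@le_trans _ _ (\sum_(m - 2 * J <= n < (m + 2 * J).+1) c n k ^+ 2)).
    by rewrite -E ?lerDr ?sqr_ge0 //; clear -mN; lia.
  rewrite -(big_mkord xpredT (fun n => c n k ^+ 2)).
  rewrite [X in _ <= X](@big_cat_nat _ _ _ (m - 2 * J)%N) //=; last by clear -mN; lia.
  by rewrite lerDr sumr_ge0 // => i _; apply: sqr_ge0.
have := le_trans low (sum_odd_le J F0).
move: HJ.
rewrite ltr_pdivrMr ?exprn_gt0 //; lra.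
Qed.

End BlaschkeDecay.

(** * Schur's test *)

Lemma powR_ge_linear (R : realType) (d e x : R) :
  0 < d -> 0 <= x <= d -> e <= 1 -> x * d `^ (e - 1) <= x `^ e.
Proof.
move=> d0 /andP[x0 xd] e1.
move: x0; rewrite le_eqVlt => /predU1P[<-|x0]; first by rewrite mul0r powR_ge0.
have -> : x `^ e = x * x `^ (e - 1).
  rewrite -[X in _ = X * _](powRr1 (ltW x0)) -powRD ?(gt_eqF x0) ?implybT //.
  by rewrite addrC subrK.
rewrite ler_pM2l // -opprB !powRN lef_pV2 ?posrE ?powR_gt0 //.
by apply: ge0_ler_powR; rewrite ?nnegrE ?subr_ge0 ?(ltW x0) ?(ltW d0).
Qed.

(* Schur's test for the symmetric matrix [(x n k * x k n) `^ (q / 2)],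
   with the same weight on both sides. *)
Lemma schur_test (R : realType) (x : nat -> nat -> R) (w : nat -> R) (q M : R)
    (P : pred nat) (b : nat) :
  (forall n k, 0 <= x n k) -> (forall n, 0 < w n) ->
  (forall k m, \sum_(n < m) x n k `^ q * w n <= M * w k) ->
  \sum_(k < b | P k) \sum_(n < b | P n) (x n k * x k n) `^ (q / 2) <= M * b%:R.
Proof.
move=> x0 w0 xM.
have M0 : 0 <= M by have := xM 0%N 0%N; rewrite big_ord0 pmulr_lge0.
(* The weights cancel in [F n k * F k n], so AM-GM bounds the symmetric entry by the mean of [F] and
   its transpose. *)
pose F n k := x n k `^ q * w n / w k.
have F0 n k : 0 <= F n k by rewrite divr_ge0 ?mulr_ge0 ?powR_ge0 // ltW.
have half n k : (x n k * x k n) `^ (q / 2) <= (F n k + F k n) / 2.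
  rewrite powRM // /F.
  have sq y : 0 <= y -> y `^ q = (y `^ (q / 2)) ^+ 2.
    by move=> y0; rewrite -powR_mulrn ?powR_ge0 // -powRrM divfK.
  rewrite !sq //; move: (x n k `^ _) (x k n `^ _) (w0 n) (w0 k) => u v.
  move: (w n) (w k) => s t s0 t0.
  have -> : (u ^+ 2 * s / t + v ^+ 2 * t / s) / 2 =
    ((u * s - v * t) ^+ 2 / (s * t)) / 2 + u * v by field; rewrite !gt_eqF.
  by rewrite lerDr divr_ge0 // divr_ge0 ?sqr_ge0 // ltW // mulr_gt0.
have bound : \sum_(k < b | P k) \sum_(n < b | P n) F n k <= M * b%:R.
  apply: (@le_trans _ _ (\sum_(k < b | P k) M)); last first.
    by rewrite sumr_const mulr_natr ler_wpMn2l // (leq_trans (max_card _)) ?card_ord.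
  apply: ler_sum => k _.
  apply: (@le_trans _ _ (\sum_(n < b) F n k)).
    by rewrite [X in _ <= X](bigID (fun n : 'I_b => P n)) /= lerDl sumr_ge0.
  by rewrite /F -mulr_suml ler_pdivrMr.
apply: (@le_trans _ _ (\sum_(k < b | P k) \sum_(n < b | P n) (F n k + F k n) / 2)).
  by apply: ler_sum => k _; apply: ler_sum.
have -> : \sum_(k < b | P k) \sum_(n < b | P n) (F n k + F k n) / 2 =
    (\sum_(k < b | P k) \sum_(n < b | P n) F n k
     + \sum_(k < b | P k) \sum_(n < b | P n) F k n) / 2.
  rewrite -big_split mulr_suml /=; apply: eq_bigr => k _.
  by rewrite -big_split mulr_suml.
rewrite [X in _ + X]exchange_big /=; lra.
Qed.

Section BlaschkeSchur.
Variables (R : realType) (r : R).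
Hypotheses (r_gt0 : 0 < r) (r_lt1 : r < 1).

Local Notation c := (blaschke_coef r).

(** Only the products [x n k * x k n] are prescribed, so that [x] can be the matrix of the [|c n k|]
    or its transpose. *)
Lemma blaschke_coef_no_schur (x : nat -> nat -> R) (w : nat -> R) (q M : R) :
  (forall n k, 0 <= x n k) -> (forall n k, x n k * x k n = `|c n k * c k n|) ->
  (forall n, 0 < w n) -> q < 2 ->
  ~ (forall k m, \sum_(n < m) x n k `^ q * w n <= M * w k).
Proof.
move=> x0 xc w0 q2 xM.
have M0 : 0 <= M by have := xM 0%N 0%N; rewrite big_ord0 pmulr_lge0.
have [L [K0 [L0 win]]] := blaschke_coef_window r_gt0 r_lt1.
have L0' : 0 < L%:R :> R by rewrite ltr0n.
have [C CE] : exists C : R, C = 2 * L%:R ^+ 2 by eexists.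
have C0 : 0 < C by rewrite CE mulr_gt0 // exprn_gt0.
(* The [L N] columns used below contribute at least [g / C / 2] each, and the choice of [g] makes
   this exceed the bound [M * b = 2 L M (L N)]. *)
have [g gE] : exists g : R, g = (4 * L%:R * M + 1) * C by eexists.
have g0 : 0 < g.
  by rewrite gE mulr_gt0 // ltr_wpDl // mulr_ge0 // mulr_ge0 // ltW.
have e1 : q / 2 - 1 < 0 by lra.
pose d := g `^ (q / 2 - 1)^-1.
have d0 : 0 < d by rewrite powR_gt0.
have dg : d `^ (q / 2 - 1) = g by rewrite -powRrM mulVf ?lt_eqF // powRr1 // ltW.
have [N0 decay] := blaschke_coef_decay r_gt0 r_lt1 C0 d0.
(* For [L N <= k < 2 L N], the window [k / L <= n < L k] of the [k]-th column lies inside the block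
   [N <= n < b]. *)
pose N := (N0 + K0).+1; pose b := (2 * L ^ 2 * N)%N.
have cmp n k : (N <= n)%N -> (k < b)%N -> k%:R <= C * n%:R.
  move=> nN kb; apply: (@le_trans _ _ b%:R); first by rewrite ler_nat ltnW.
  by rewrite /b CE -natrX -!natrM ler_nat leq_mul2l nN orbT.
(* By symmetry [c k n = (n / k) * c n k] with [n / k >= C^-1] on the block; as the product is at
   most [d], its power [q / 2] gains the factor [g]. *)
have key n k : (N <= n < b)%N -> (N <= k < b)%N ->
    g / C * c n k ^+ 2 <= (x n k * x k n) `^ (q / 2).
  move=> /andP[nN nb] /andP[kN kb].
  have n0 : 0 < n%:R :> R by rewrite ltr0n; apply: leq_trans nN.
  have k0 : 0 < k%:R :> R by rewrite ltr0n; apply: leq_trans kN.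
  have ckn : c k n = n%:R / k%:R * c n k.
    by apply: (mulfI (lt0r_neq0 k0)); rewrite -blaschke_coef_sym; field; rewrite gt_eqF.
  rewrite xc; apply: le_trans (@powR_ge_linear _ d (q / 2) _ d0 _ _); last 2 first.
  - rewrite normr_ge0 normrM -[X in _ <= X]mulr1.
    apply: ler_pM => //; last exact: blaschke_coef_le1.
    apply: decay; last exact: cmp.
    by apply: leq_trans nN; rewrite /N -addnS leq_addr.
  - lra.
  have -> : `|c n k * c k n| = n%:R / k%:R * c n k ^+ 2.
    by rewrite ckn mulrCA -expr2 normrM (ger0_norm (sqr_ge0 _)) ger0_norm ?divr_ge0.
  have h : C^-1 <= n%:R / k%:R.
    by rewrite ler_pdivlMr // mulrC ler_pdivrMr // mulrC cmp.
  rewrite dg (_ : g / C * _ = C^-1 * c n k ^+ 2 * g); last by ring.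
  by rewrite ler_pM2r // ler_wpM2r ?sqr_ge0.
have low : (L * N)%:R * (g / C / 2) <=
    \sum_(k < b | (N <= k)%N) \sum_(n < b | (N <= n)%N) (x n k * x k n) `^ (q / 2).
  have Lb : (2 * (L * N) <= b)%N by rewrite /b; clear -L0; nia.
  apply: (@le_trans _ _ (\sum_(k < b | (N <= k)%N) if (L * N <= k < 2 * (L * N))%N then g / C / 2 else 0)).
    have -> : (L * N)%:R * (g / C / 2) = \sum_(L * N <= k < 2 * (L * N)) (g / C / 2).
      by rewrite sumr_const_nat mulr_natl mul2n -addnn addnK.
    rewrite big_geq_mkord (big_ord_widen_cond _ (fun k => (L * N <= k)%N) (fun=> g / C / 2) Lb).
    rewrite -big_mkcondr le_eqVlt; apply/orP; left; apply/eqP/eq_bigl => k /=.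
    case: (leqP (L * N) k) => [LNk|]; last by rewrite andbF.
    by rewrite (leq_trans _ LNk) // leq_pmull.
  apply: ler_sum => k Nk; case: ifP => [/andP[k1 k2]|_]; last first.
    by apply: sumr_ge0 => n _; rewrite powR_ge0.
  have kK0 : (K0 <= k)%N.
    by apply: leq_trans k1; clear -L0; rewrite /N; nia.
  have h := win k kK0.
  have gC : 0 < g / C by rewrite divr_gt0.
  apply: (@le_trans _ _ (g / C * \sum_(n < L * k | (k <= L * n)%N) c n k ^+ 2)).
    by rewrite ler_pM2l.
  have Lkb : (L * k <= b)%N.
    apply: (@leq_trans (L * (2 * (L * N)))); last by rewrite /b -mulnn; clear; nia.
    by rewrite leq_mul2l ltnW ?orbT.
  rewrite mulr_sumr (big_ord_widen_cond _ (fun n => (k <= L * n)%N) (fun n => g / C * c n k ^+ 2) Lkb).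
  rewrite big_mkcond [X in _ <= X]big_mkcond; apply: ler_sum => n _ /=.
  case: ifP => [/andP[kn nk]|_]; last by case: ifP => // _; rewrite powR_ge0.
  have Nn : (N <= n)%N by rewrite -(leq_pmul2l L0) (leq_trans k1).
  by rewrite Nn key ?Nn ?ltn_ord ?Nk.
have := le_trans low (schur_test (fun n => (N <= n)%N) b x0 w0 xM).
rewrite gE mulfK ?gt_eqF //.
have -> : b%:R = 2 * L%:R * (L * N)%:R :> R by rewrite /b -!natrM; congr (_%:R); clear; nia.
have : 0 < (L * N)%:R :> R by rewrite ltr0n muln_gt0 L0.
move: ((L * N)%:R) => y y0; lra.
Qed.
End BlaschkeSchur.

(** * Complex power series *)

Section ComplexSeries.
Local Open Scope classical_set_scope.
Variable R : realType.
Local Notation normc := (@Normc.normc R).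

Lemma normc_ge0 (z : R[i]) : 0 <= normc z.
Proof. by case: z => x y; exact: sqrtr_ge0. Qed.

Lemma normcX (z : R[i]) n : normc (z ^+ n) = normc z ^+ n.
Proof.
elim: n => [|n IH]; first by rewrite !expr0 (@Normc.normc1 R).
by rewrite !exprS Normc.normcM IH.
Qed.

Lemma normc_real (x : R) : normc x%:C = `|x|.
Proof. by rewrite /= expr0n addr0 sqrtr_sqr. Qed.

Lemma le_normc_sum (F : nat -> R[i]) n :
  normc (\sum_(i < n) F i) <= \sum_(i < n) normc (F i).
Proof.
elim: n => [|n IH]; first by rewrite !big_ord0 (@Normc.normc0 R).
by rewrite !big_ord_recr /= (le_trans (le_normcD _ _)) // lerD2r.
Qed.

Lemma cvg_normcP (u : nat -> R[i]) (l : R[i]) :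
  ((u : nat -> R[i]^o) @ \oo --> (l : R[i]^o)) <->
  forall e : R, 0 < e -> exists N, forall n, (N <= n)%N -> normc (l - u n) < e.
Proof.
split => [/cvgrPdist_lt H e e0|H].
  have ec0 : 0 < e%:C by rewrite ltcR.
  have [N _ HN] := H _ ec0; exists N => n nN.
  by have := HN n nN; rewrite /= [`|_|]/(normc _)%:C ltcR.
apply/cvgrPdist_lt => e e0.
(* The radii of balls in [R[i]^o] are elements of [R[i]]; a positive one is real. *)
have eE : e = (complex.Re e)%:C by rewrite RRe_real // gtr0_real.
have e0' : 0 < complex.Re e by rewrite -ltcR -eE.
have [N HN] := H _ e0'.
exists N => // n nN /=; rewrite eE.
by have := HN n nN; rewrite -ltcR.
Qed.

Lemma unit_diskP (z : R[i]) : unit_disk z <-> normc z < 1.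
Proof. by rewrite /unit_disk /= -[1]/(1%:C) ltcR. Qed.

Lemma power_series_poly (x : nat -> R[i]) (K : nat) :
  power_series_on_disk (fun z => \sum_(k < K) x k * z ^+ k)
    (fun n => if (n < K)%N then x n else 0).
Proof.
move=> z _; apply: cvg_near_cst; exists K => // n /= Kn.
rewrite /series /= big_mkord (big_ord_widen_cond _ xpredT (fun k => x k * z ^+ k) Kn) [RHS]big_mkcond.
by apply: eq_bigr => i _ /=; case: ifP; rewrite ?mul0r.
Qed.

(** Convergence at [1/2] bounds the difference [d n] by [K * 2 ^+ n]. If all earlier differences
    vanish, evaluation at a small real [t] gives [d n * t ^ n = O(t ^ (n + 1))]. *)
Lemma power_series_on_disk_unique (f : R[i] -> R[i]) (a b : nat -> R[i]) :
  power_series_on_disk f a -> power_series_on_disk f b -> a = b.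
Proof.
move=> fa fb.
pose d n := a n - b n.
suff d0 : forall n, d n = 0 by apply/funext => n; apply/eqP; rewrite -subr_eq0 -/(d n) d0.
have dS (t e : R) : 0 < t < 1 -> 0 < e -> exists N, forall m, (N <= m)%N ->
    normc (\sum_(n < m) d n * t%:C ^+ n) < e.
  move=> /andP[t0 t1] e0.
  have tD : unit_disk (t%:C : R[i]) by apply/unit_diskP; rewrite normc_real gtr0_norm.
  have e20 : 0 < e / 2 by rewrite divr_gt0.
  have /cvg_normcP/(_ _ e20)[N1 H1] := fa _ tD.
  have /cvg_normcP/(_ _ e20)[N2 H2] := fb _ tD.
  exists (maxn N1 N2) => m; rewrite geq_max => /andP[m1 m2].
  have -> : \sum_(n < m) d n * t%:C ^+ n =
     (f t%:C - series (fun n => b n * t%:C ^+ n) m)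
     - (f t%:C - series (fun n => a n * t%:C ^+ n) m).
    rewrite /series /= !big_mkord opprB addrC addrA subrK -sumrB.
    by apply: eq_bigr => i _; rewrite /d mulrBl.
  apply: le_lt_trans (le_normcD _ _) _.
  rewrite normcN; have := H1 _ m1; have := H2 _ m2; lra.
have [K K0 dK] : exists2 K : R, 0 < K & forall n, normc (d n) <= K * 2 ^+ n.
  have [|N HN] := dS 2^-1 1 _ ltr01; first by rewrite invr_gt0 invf_lt1; lra.
  pose K := 2 + \sum_(n < N) normc (d n).
  have S0 : 0 <= \sum_(n < N) normc (d n) by apply: sumr_ge0 => i _; apply: normc_ge0.
  exists K; first by rewrite /K; lra.
  move=> n; have p1 : 1 <= 2 ^+ n :> R by apply: exprn_ege1; lra.
  case: (ltnP n N) => nN.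
    rewrite -[X in X <= _]mulr1; apply: ler_pM => //; first exact: normc_ge0.
    rewrite /K (bigD1 (Ordinal nN)) //=.
    have : 0 <= \sum_(i < N | i != Ordinal nN) normc (d i) by apply: sumr_ge0 => i _; apply: normc_ge0.
    have := normc_ge0 (d n); lra.
  have E : d n * 2^-1%:C ^+ n = \sum_(i < n.+1) d i * 2^-1%:C ^+ i - \sum_(i < n) d i * 2^-1%:C ^+ i.
    by rewrite big_ord_recr /= addrAC subrr add0r.
  have : normc (d n * 2^-1%:C ^+ n) <= 2.
    rewrite E; apply: le_trans (le_normcD _ _) _; rewrite normcN.
    have := HN _ nN; have := HN n.+1 (leqW nN); lra.
  rewrite Normc.normcM normcX normc_real ger0_norm ?invr_ge0 // exprVn ler_pdivrMr ?exprn_gt0 //.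
  move=> h; apply: (le_trans h); rewrite ler_wpM2r ?exprn_ge0 // /K; lra.
elim/ltn_ind => n IH.
apply: (@Normc.eq0_normc R); apply/eqP; rewrite eq_le normc_ge0 andbT.
apply/ler_addgt0Pl => e e0; rewrite addr0.
(* [B] collects the tail, at most [2 K (2 t) ^ (n + 1)], and the allowed size [K t ^ (n + 1)] of the
   partial sum; [t <= 1/4] makes the tail geometric of ratio at most [1/2]. *)
pose B := K * (2 ^+ n.+2 + 1); have B0 : 0 < B by rewrite mulr_gt0 // addr_gt0 // exprn_gt0.
pose t := Num.min 4^-1 (e / B).
have t0 : 0 < t by rewrite lt_min invr_gt0 ltr0n /= divr_gt0.
have t4 : t <= 4^-1 by rewrite ge_min lexx.
have tB : t * B <= e by rewrite -ler_pdivlMr // ge_min lexx orbT.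
have [|N HN] := dS t (t ^+ n.+1 * K) _ (mulr_gt0 (exprn_gt0 _ t0) K0).
  by rewrite t0; lra.
have := HN (n.+1 + N)%N (leq_addl _ _).
rewrite big_split_ord /= big_ord_recr big1 ?add0r /=; last first.
  by move=> i _; rewrite IH ?mul0r.
set S := \sum_(i < N) _ => HS.
have SB : normc S <= K * (2 * t) ^+ n.+1 * 2.
  apply: (le_trans (le_normc_sum (fun i => d (n.+1 + i)%N * t%:C ^+ (n.+1 + i)) N)).
  apply: (@le_trans _ _ (\sum_(i < N) K * (2 * t) ^+ n.+1 * 2^-1 ^+ i)).
    apply: ler_sum => i _.
    rewrite Normc.normcM normcX normc_real (gtr0_norm t0).
    have : 2 ^+ i * t ^+ i <= 2^-1 ^+ i.
      by rewrite -exprMn lerXn2r ?nnegrE ?mulr_ge0 ?invr_ge0 ?(ltW t0) //; lra.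
    have := dK (n.+1 + i)%N.
    move=> h1 h2.
    apply: (@le_trans _ _ (K * 2 ^+ (n.+1 + i) * t ^+ (n.+1 + i))).
      by rewrite ler_wpM2r ?exprn_ge0 // ltW.
    rewrite !exprD exprMn.
    have -> : K * (2 ^+ n.+1 * 2 ^+ i) * (t ^+ n.+1 * t ^+ i) =
      K * (2 ^+ n.+1 * t ^+ n.+1) * (2 ^+ i * t ^+ i) by ring.
    by rewrite ler_wpM2l // mulr_ge0 ?(ltW K0) // mulr_ge0 ?exprn_ge0 // ltW.
  rewrite -mulr_sumr ler_wpM2l //.
    by rewrite mulr_ge0 ?(ltW K0) // exprn_ge0 // mulr_ge0 // ltW.
  suff -> : \sum_(i < N) 2^-1 ^+ i = 2 - 2 * 2^-1 ^+ N :> R.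
    by rewrite gerBl mulr_ge0 // exprn_ge0 // invr_ge0.
  elim: N {HN S HS} => [|N IHN]; first by rewrite big_ord0; ring.
  by rewrite big_ord_recr /= IHN (exprS _ N); field.
have : normc (d n * t%:C ^+ n) < t ^+ n.+1 * K + K * (2 * t) ^+ n.+1 * 2.
  have -> : d n * t%:C ^+ n = d n * t%:C ^+ n + S - S by rewrite addrK.
  apply: le_lt_trans (le_normcD _ _) _; rewrite normcN; rewrite add0r in HS; exact: ltr_leD.
rewrite Normc.normcM normcX normc_real (gtr0_norm t0).
have -> : t ^+ n.+1 * K + K * (2 * t) ^+ n.+1 * 2 = (t * B) * t ^+ n.
  by rewrite /B exprMn !exprS; ring.
by rewrite ltr_pM2r ?exprn_gt0 // => /ltW/le_trans; apply.
Qed.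

End ComplexSeries.

(* Conjugating by a rotation reduces [T_a] to real [a = r > 0], up to phases. *)
Definition aut_coef (R : realType) (a : R[i]) (n k : nat) : R[i] :=
  let u := a / `|a| in
  u ^+ k * (- conjc u) ^+ n * (blaschke_coef (Normc.normc a) n k)%:C.

(** * Taylor expansion of the powers of the automorphism *)

Section AutPowers.
Local Open Scope classical_set_scope.
Variables (R : realType) (a : R[i]).
Hypotheses (a_disk : unit_disk a) (a_neq0 : a <> 0).
Local Notation normc := (@Normc.normc R).
Local Notation r := (normc a).
Local Notation u := (a / `|a|).

Let r_gt0 : 0 < r.
Proof.
rewrite lt_def normc_ge0 andbT; apply/eqP => /(@Normc.eq0_normc R); exact: a_neq0.
Qed.

Let r_lt1 : r < 1.
Proof. by move: a_disk => /unit_diskP. Qed.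

Let normc_u : normc u = 1.
Proof.
rewrite Normc.normcM (@Normc.normcV R) -[`|a|]/((normc a)%:C) normc_real gtr0_norm //.
by rewrite divff // gt_eqF.
Qed.

Lemma normc_conj (z : R[i]) : normc (conjc z) = normc z.
Proof. by case: z => x y /=; rewrite sqrrN. Qed.

Let uuc : u * conjc u = 1.
Proof. by rewrite -sqr_normc -[`|u|]/((normc u)%:C) normc_u expr1n. Qed.

Let a_u : a = u * r%:C.
Proof. by rewrite -[r%:C]/(`|a|) divfK // normr_eq0; apply/eqP. Qed.

Let ac_u : conjc a = conjc u * r%:C.
Proof. by rewrite {1}a_u rmorphM /= oppr0. Qed.

Lemma normc_aut_coef n k : normc (aut_coef a n k) = `|blaschke_coef r n k|.
Proof.
rewrite /aut_coef !Normc.normcM !normcX normcN normc_conj normc_u !expr1n !mul1r.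
exact: normc_real.
Qed.

Lemma aut_coef0S k : aut_coef a 0 k.+1 = a * aut_coef a 0 k.
Proof.
transitivity (u * r%:C * aut_coef a 0 k); last by rewrite -a_u.
rewrite /aut_coef !expr0 !mulr1 !blaschke_coef0 exprS (exprS r) rmorphM /=.
by ring.
Qed.

(** The coefficient of [z ^ (n + 1)] in [(1 + conjc a * z) T_a ^ (k + 1) = (a + z) T_a ^ k]. *)
Lemma aut_coefSS n k : aut_coef a n.+1 k.+1 =
  a * aut_coef a n.+1 k - conjc a * aut_coef a n k.+1 + aut_coef a n k.
Proof.
transitivity (u * r%:C * aut_coef a n.+1 k
   - conjc u * r%:C * aut_coef a n k.+1 + aut_coef a n k); last by rewrite -a_u -ac_u.
rewrite /aut_coef; move: uuc; set v := u; set w := conjc v => vw.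
rewrite blaschke_coefSS rmorphD rmorphB !rmorphM /= !exprS.
set c1 := (blaschke_coef _ _ _)%:C; set c2 := (blaschke_coef _ _ _)%:C.
set c3 := (blaschke_coef _ _ _)%:C.
have -> : v ^+ k * (- w) ^+ n * c2 = (v * w) * (v ^+ k * (- w) ^+ n * c2).
  by rewrite vw mul1r.
by ring.
Qed.

Lemma disk_aut_den_neq0 (z : R[i]) : unit_disk z -> 1 + conjc a * z != 0.
Proof.
move=> /unit_diskP z1; apply/eqP => h.
have az : conjc a * z = - 1 by apply/eqP; rewrite -addr_eq0 addrC h.
have := congr1 normc az; rewrite normcN (@Normc.normc1 R) Normc.normcM normc_conj => E.
have z0 := normc_ge0 z; have r1 := r_lt1; have r0 := r_gt0; nra.
Qed.

(** By the recurrence, the partial sums for [k + 1] are [T_a] times those for [k] up to boundary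
    terms, which vanish in the limit because the coefficients are bounded by [1] and [|z| < 1]. *)
Lemma power_series_aut_pow (k : nat) :
  power_series_on_disk (fun z => disk_aut a z ^+ k) (fun n => aut_coef a n k).
Proof.
move=> z zD; have /unit_diskP z1 := zD; have den := disk_aut_den_neq0 zD.
elim: k => [|k IH].
  rewrite expr0; apply: cvg_near_cst; exists 1%N => // -[//|n] _.
  rewrite /series /= big_mkord big_ord_recl /= big1 ?addr0 => [|i _].
    by rewrite /aut_coef blaschke_coef0 !expr0 !mulr1.
  by rewrite /aut_coef blaschke_coefS0 rmorph0 !mulr0 mul0r.
pose S j : nat -> R[i]^o := series (fun n => aut_coef a n j * z ^+ n : R[i]^o).
have SE m : S k.+1 m.+1 = disk_aut a z * S k m.+1 +
    (1 + conjc a * z)^-1 * (conjc a * (aut_coef a m k.+1 * z ^+ m.+1) - aut_coef a m k * z ^+ m.+1).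
  have wT : (1 + conjc a * z) * disk_aut a z = a + z by rewrite mulrC divfK.
  apply: (mulfI den); rewrite [RHS]mulrDr [X in _ = X + _]mulrA wT.
  rewrite [X in _ = _ + X]mulrA divff // mul1r.
  elim: m => [|m IHm].
    rewrite /S /series /= !big_mkord !big_ord1 !expr0 aut_coef0S expr1; ring.
  have SS j : S j m.+2 = S j m.+1 + aut_coef a m.+1 j * z ^+ m.+1.
    by rewrite /S /series /= !big_mkord big_ord_recr.
  rewrite !SS !mulrDr IHm aut_coefSS !(exprS z m.+1); ring.
have small j : (fun m => aut_coef a m j * z ^+ m.+1 : R[i]^o) @ \oo --> (0 : R[i]^o).
  apply/cvg_normcP => e e0.
  have e20 : 0 < e / 2 by rewrite divr_gt0.
  have [z0|z0] := eqVneq z 0.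
    by exists 0%N => n _; rewrite z0 exprS mul0r mulr0 subr0 (@Normc.normc0 R).
  have nz : 0 < normc z.
    by rewrite lt_def normc_ge0 andbT; apply: contra_neq z0; apply: Normc.eq0_normc.
  have [|N HN] := expr_small (_ : 0 < normc z < 1) e20; first by rewrite nz z1.
  exists N => n nN; rewrite sub0r normcN Normc.normcM normcX normc_aut_coef.
  have := HN n.+1 (leqW nN); have := blaschke_coef_le1 r_gt0 r_lt1 n j.
  have := exprn_ge0 n.+1 (normc_ge0 z); have := normr_ge0 (blaschke_coef r n j).
  move: (normc z ^+ _) (`|_|) => x y; nra.
rewrite -cvg_shiftS.
have -> : [sequence series (fun n => aut_coef a n k.+1 * z ^+ n : R[i]^o) n.+1]_n =
  (fun m => disk_aut a z * S k m.+1 +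
    (1 + conjc a * z)^-1 * (conjc a * (aut_coef a m k.+1 * z ^+ m.+1) - aut_coef a m k * z ^+ m.+1)).
  by apply/funext => m; rewrite /= -SE.
have -> : disk_aut a z ^+ k.+1 = disk_aut a z * disk_aut a z ^+ k +
    (1 + conjc a * z)^-1 * (conjc a * 0 - 0) by rewrite exprS mulr0 subr0 mulr0 addr0.
apply: (@cvgD _ R[i]^o).
  apply: (@cvgMl_tmp R[i]).
  by move: IH; rewrite -cvg_shiftS.
apply: (@cvgMl_tmp R[i]); apply: (@cvgB _ R[i]^o); last exact: small.
by apply: (@cvgMl_tmp R[i]); apply: small.
Qed.

Lemma power_series_comp_poly (x : nat -> R[i]) (K : nat) :
  power_series_on_disk (comp_op (disk_aut a) (fun z => \sum_(k < K) x k * z ^+ k))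
    (fun n => \sum_(k < K) x k * aut_coef a n k).
Proof.
move=> z zD; rewrite /comp_op /=.
elim: K => [|K IH].
  rewrite big_ord0; apply: cvg_near_cst; exists 0%N => // n _.
  by rewrite /series /= big1 // => i _; rewrite big_ord0 mul0r.
rewrite big_ord_recr /=.
have -> : series (fun n => (\sum_(k < K.+1) x k * aut_coef a n k) * z ^+ n : R[i]^o) =
   (fun n => series (fun n => (\sum_(k < K) x k * aut_coef a n k) * z ^+ n : R[i]^o) n +
     x K * series (fun n => aut_coef a n K * z ^+ n : R[i]^o) n).
  apply/funext => n; rewrite /series /= mulr_sumr -big_split /=.
  by apply: eq_bigr => i _; rewrite big_ord_recr mulrDl mulrA.
apply: (@cvgD _ R[i]^o) => //.
by apply: (@cvgMl_tmp R[i]); apply: power_series_aut_pow.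
Qed.

End AutPowers.

Lemma taylor_coefE (R : realType) (f : R[i] -> R[i]) (c : nat -> R[i]) :
  power_series_on_disk f c -> taylor_coef f = c.
Proof.
by move=> fc; apply: xget_unique => // d fd; apply: power_series_on_disk_unique fd fc.
Qed.

(** The operator is tested on polynomials, where uniqueness makes both Taylor sequences explicit. *)
Lemma bounded_on_h_seq_norm (R : realType) (p : \bar R) (beta : nat -> R) (a : R[i]) :
  unit_disk a -> a <> 0 -> bounded_on_h p beta (comp_op (disk_aut a)) ->
  exists M : R, forall (x : nat -> R[i]) (K : nat),
    (seq_norm p beta (fun n => if (n < K)%N then x n else 0%R) < +oo)%E ->
    (seq_norm p beta (fun n => (\sum_(k < K) x k * aut_coef a n k)%R) <=
     M%:E * seq_norm p beta (fun n => if (n < K)%N then x n else 0%R))%E.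
Proof.
move=> aD a0 [_ [M HM]]; exists M => x K fin.
have E1 := taylor_coefE (@power_series_poly _ x K).
have E2 := taylor_coefE (@power_series_comp_poly _ _ aD a0 x K).
have := HM (fun z => \sum_(k < K) x k * z ^+ k).
rewrite /h_norm E1 E2; apply; split; last by rewrite /h_norm E1.
by exists (fun n => if (n < K)%N then x n else 0); apply: power_series_poly.
Qed.

(** * From boundedness to matrix inequalities *)

Section SeqNorm.
Variables (R : realType) (beta : nat -> R).
Hypothesis beta_gt0 : forall n, 0 < beta n.
Local Notation normc := (@Normc.normc R).

Lemma seq_norm_trunc (p : R) (x : nat -> R[i]) (K : nat) : 0 < p ->
  seq_norm p%:E beta (fun n => if (n < K)%N then x n else 0) =
  ((\sum_(k < K) normc (x k) `^ p * beta k) `^ p^-1)%:E.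
Proof.
move=> p0; rewrite /seq_norm -poweR_EFin; congr poweR.
apply: lim_near_cst => //; exists K => // n /= Kn.
rewrite -sumEFin big_mkord [RHS](big_ord_widen_cond _ xpredT (fun k => (normc (x k) `^ p * beta k)%:E) Kn).
rewrite [RHS]big_mkcond /=; apply: eq_bigr => i _; case: ifP => // _.
by rewrite (@Normc.normc0 R) powR0 ?gt_eqF // mul0r.
Qed.

Lemma seq_norm_ge_partial (p : R) (y : nat -> R[i]) (m : nat) : 0 < p ->
  (((\sum_(n < m) normc (y n) `^ p * beta n) `^ p^-1)%:E <= seq_norm p%:E beta y)%E.
Proof.
move=> p0; rewrite /seq_norm -poweR_EFin.
have t0 n : 0 <= normc (y n) `^ p * beta n by rewrite mulr_ge0 ?powR_ge0 // ltW.
have le1 : ((\sum_(n < m) normc (y n) `^ p * beta n)%:E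
    <= \sum_(0 <= n <oo) (normc (y n) `^ p * beta n)%:E)%E.
  rewrite -sumEFin -(big_mkord xpredT (fun n => (normc (y n) `^ p * beta n)%:E)).
  by apply: nneseries_lim_ge => n _ _; rewrite lee_fin.
have le0 : (0 <= (\sum_(n < m) normc (y n) `^ p * beta n)%:E)%E.
  by rewrite lee_fin sumr_ge0.
apply: gt0_ler_poweR => //; first by rewrite invr_ge0 ltW.
  by rewrite in_itv /= le0 leey.
by rewrite in_itv /= (le_trans le0 le1) leey.
Qed.

End SeqNorm.

Section Bridge.
Variables (R : realType) (beta : nat -> R) (a : R[i]).
Hypotheses (beta_gt0 : forall n, 0 < beta n) (aD : unit_disk a) (a0 : a <> 0).
Local Notation normc := (@Normc.normc R).
Local Notation c := (blaschke_coef (normc a)).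

Lemma bounded_on_h_matrix (p : R) : 0 < p ->
  bounded_on_h p%:E beta (comp_op (disk_aut a)) ->
  exists2 M : R, 0 <= M & forall (x : nat -> R[i]) (K m : nat),
    \sum_(n < m) normc (\sum_(k < K) x k * aut_coef a n k) `^ p * beta n <=
    M * \sum_(k < K) normc (x k) `^ p * beta k.
Proof.
move=> p0 /(bounded_on_h_seq_norm aD a0)[M HM].
(* The constant [M] may be negative, hence the absolute value; the power [p] undoes the root in the
   norm. *)
exists (`|M| `^ p) => [|x K m]; first exact: powR_ge0.
have := HM x K; rewrite seq_norm_trunc // => /(_ (ltry _)).
move=> /(le_trans (seq_norm_ge_partial beta_gt0 _ m p0)).
rewrite -EFinM lee_fin.
set S := \sum_(n < m) _; set T := \sum_(k < K) _ => H.
have S0 : 0 <= S by apply: sumr_ge0 => i _; rewrite mulr_ge0 ?powR_ge0 // ltW.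
have T0 : 0 <= T by apply: sumr_ge0 => i _; rewrite mulr_ge0 ?powR_ge0 // ltW.
have H' : S `^ p^-1 <= `|M| * T `^ p^-1.
  by apply: (le_trans H); rewrite ler_wpM2r ?powR_ge0 // ler_norm.
have := ge0_ler_powR (ltW p0) _ _ H'; rewrite !nnegrE mulr_ge0 ?powR_ge0 // => /(_ isT isT).
by rewrite powRM ?powR_ge0 // -!powRrM mulVf ?gt_eqF // !powRr1.
Qed.

(** The test function is [z ^ k], whose image has the [k]-th column as its coefficients. *)
Lemma bounded_on_h_columns (p : R) : 0 < p ->
  bounded_on_h p%:E beta (comp_op (disk_aut a)) ->
  exists M : R, forall k m,
    \sum_(n < m) `|c n k| `^ p * beta n <= M * beta k.
Proof.
move=> p0 /(bounded_on_h_matrix p0)[M _ HM]; exists M => k m.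
pose x (j : nat) : R[i] := (j == k)%:R.
have xk : x k = 1 by rewrite /x eqxx.
have x0 j : (j < k)%N -> x j = 0 by move=> jk; rewrite /x ltn_eqF.
have S1 : \sum_(j < k.+1) normc (x j) `^ p * beta j = beta k.
  rewrite big_ord_recr /= xk (@Normc.normc1 R) powR1 mul1r big1 ?add0r // => i _.
  by rewrite x0 // (@Normc.normc0 R) powR0 ?gt_eqF // mul0r.
have S2 n : \sum_(j < k.+1) x j * aut_coef a n j = aut_coef a n k.
  by rewrite big_ord_recr /= xk mul1r big1 ?add0r // => i _; rewrite x0 // mul0r.
have := HM x k.+1 m; rewrite S1; apply: le_trans.
by apply: ler_sum => n _; rewrite S2 normc_aut_coef.
Qed.

(* The extremal sequence of Hölder's inequality for the [n]-th row. *)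
Definition dual_test (q : R) (w : nat -> R) (n k : nat) : R[i] :=
  conjc (aut_coef a n k) * (`|c n k| `^ (q - 2) * w k)%:C.

(** The conjugate aligns all phases along the row, so nothing cancels. *)
Lemma dual_test_sum (q : R) (w : nat -> R) n K : (forall k, 0 < w k) -> 0 < q ->
  normc (\sum_(k < K) dual_test q w n k * aut_coef a n k) =
  \sum_(k < K) `|c n k| `^ q * w k.
Proof.
move=> w0 q0.
have -> : \sum_(k < K) dual_test q w n k * aut_coef a n k =
    (\sum_(k < K) `|c n k| `^ q * w k)%:C.
  rewrite rmorph_sum; apply: eq_bigr => k _ /=.
  rewrite /dual_test mulrAC [conjc _ * _]mulrC -sqr_normc -[`|_|]/((normc _)%:C).
  rewrite normc_aut_coef // -rmorphXn -rmorphM /=; congr (_%:C); rewrite mulrA; congr (_ * _).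
  have [->|c0] := eqVneq (c n k) 0; first by rewrite normr0 expr0n mul0r powR0 // gt_eqF.
  rewrite -powR_mulrn // -powRD ?normr_eq0 ?c0 ?implybT //; congr (_ `^ _); ring.
by rewrite normc_real ger0_norm // sumr_ge0 // => k _; rewrite mulr_ge0 ?powR_ge0 // ltW.
Qed.

Lemma normc_dual_test (q : R) (w : nat -> R) n k : (forall k, 0 < w k) ->
  normc (dual_test q w n k) <= `|c n k| `^ (q - 1) * w k.
Proof.
move=> w0; rewrite Normc.normcM normc_conj normc_aut_coef // normc_real.
have h : 0 <= `|c n k| `^ (q - 2) * w k by rewrite mulr_ge0 ?powR_ge0 // ltW.
rewrite (ger0_norm h) mulrA ler_wpM2r ?(ltW (w0 k)) //.
have [->|c0] := eqVneq (c n k) 0; first by rewrite normr0 mul0r powR_ge0.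
rewrite -[X in X * _](powRr1 (normr_ge0 _)) -powRD ?normr_eq0 ?c0 ?implybT //.
by rewrite (_ : 1 + _ = q - 1) //; ring.
Qed.

Lemma bounded_on_h_rows (p q : R) : 1 < q -> p^-1 + q^-1 = 1 ->
  bounded_on_h p%:E beta (comp_op (disk_aut a)) ->
  exists M : R, forall n K,
    \sum_(k < K) `|c n k| `^ q * beta k `^ (1 - q) <= M * beta n `^ (1 - q).
Proof.
move=> q1 pq; have q0 : 0 < q by lra.
have pE : p = q / (q - 1).
  have : p^-1 = (q - 1) / q by rewrite mulrBl divff ?gt_eqF // mul1r -pq addrK.
  by move=> /(congr1 GRing.inv); rewrite invrK invf_div.
have p1 : p - 1 = (q - 1)^-1 by rewrite pE; field; rewrite gt_eqF //; lra.
have q10 : 0 < q - 1 by lra.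
have p0 : 0 < p by rewrite pE divr_gt0.
have p10 : 0 < p - 1 by rewrite p1 invr_gt0.
move=> /(bounded_on_h_matrix p0)[M M0 HM]; exists (M `^ (q - 1)) => n K.
pose w k := beta k `^ (1 - q); have w0 k : 0 < w k by rewrite powR_gt0.
have := HM (dual_test q w n) K n.+1; rewrite big_ord_recr /= dual_test_sum //.
rewrite -/(w n); set T := \sum_(k < K) `|c n k| `^ q * w k; set S := \sum_(i < n) _.
have S0 : 0 <= S by apply: sumr_ge0 => i _; rewrite mulr_ge0 ?powR_ge0 // ltW.
move=> H.
have H1 : T `^ p * beta n <= M * T.
  apply: (@le_trans _ _ (S + T `^ p * beta n)); first by rewrite lerDr.
  apply: (le_trans H); rewrite ler_wpM2l // /T; apply: ler_sum => k _.
  apply: (@le_trans _ _ ((`|c n k| `^ (q - 1) * w k) `^ p * beta k)).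
    rewrite ler_wpM2r ?(ltW (beta_gt0 k)) //.
    by apply: ge0_ler_powR; rewrite ?nnegrE ?(ltW p0) ?normc_ge0 ?mulr_ge0 ?powR_ge0 ?normc_dual_test.
  rewrite powRM ?powR_ge0 // -powRrM /w -powRrM.
  have -> : (q - 1) * p = q by rewrite pE mulrC divfK // gt_eqF.
  suff -> : `|c n k| `^ q * beta k `^ ((1 - q) * p) * beta k = `|c n k| `^ q * w k by [].
  rewrite -mulrA; congr (_ * _).
  rewrite -[X in _ * X](powRr1 (ltW (beta_gt0 k))) -powRD ?(gt_eqF (beta_gt0 k)) ?implybT //.
  by congr (_ `^ _); rewrite pE; field; rewrite gt_eqF.
have T0 : 0 <= T by apply: sumr_ge0 => i _; rewrite mulr_ge0 ?powR_ge0 // ltW.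
move: T0; rewrite le_eqVlt => /predU1P[<-|T0]; first by rewrite mulr_ge0 ?powR_ge0.
have H2 : T `^ (p - 1) <= M / beta n.
  rewrite ler_pdivlMr // -(ler_pM2l T0) mulrA [X in _ <= X]mulrC.
  rewrite -[X in X * _ * _](powRr1 (ltW T0)) -powRD ?(gt_eqF T0) ?implybT //.
  by rewrite addrC subrK.
have := ge0_ler_powR (ltW q10) _ _ H2.
rewrite !nnegrE powR_ge0 divr_ge0 ?(ltW (beta_gt0 n)) // => /(_ isT isT).
rewrite -powRrM p1 mulVf ?gt_eqF // powRr1 ?(ltW T0) // => /le_trans; apply.
rewrite powRM ?invr_ge0 ?(ltW (beta_gt0 n)) // -powR_inv1 ?(ltW (beta_gt0 n)) // -powRrM /w.
by rewrite mulN1r opprB.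
Qed.

End Bridge.

(** * Unboundedness for every exponent other than 2 *)

Section Unbounded.
Variables (R : realType) (beta : nat -> R) (a : R[i]).
Hypotheses (beta_gt0 : forall n, 0 < beta n) (aD : unit_disk a) (a0 : a <> 0).
Local Notation normc := (@Normc.normc R).
Local Notation c := (blaschke_coef (normc a)).

(** The dual exponent is [q = 1]: the test sequence has weighted sup norm at most [1], and the
    [n]-th coefficient of its image is the whole row sum. *)
Lemma bounded_on_h_rows_pinfty :
  bounded_on_h +oo%E beta (comp_op (disk_aut a)) ->
  exists M : R, forall n K,
    \sum_(k < K) `|c n k| `^ 1 * (beta k)^-1 <= M * (beta n)^-1.
Proof.
move=> /(bounded_on_h_seq_norm aD a0)[M HM]; exists `|M| => n K.
pose w k := (beta k)^-1; have w0 k : 0 < w k by rewrite invr_gt0.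
have ub k (y : nat -> R[i]) : ((normc (y k) * beta k)%:E <= seq_norm +oo%E beta y)%E.
  by apply: ereal_sup_ubound; exists k.
pose x k : R[i] := if (k < K)%N then dual_test a 1 w n k else 0.
have x1 : (seq_norm +oo%E beta x <= 1%:E)%E.
  apply: ge_ereal_sup => _ [k _ <-]; rewrite lee_fin /x.
  case: ifP => _; last by rewrite (@Normc.normc0 R) mul0r.
  rewrite -ler_pdivlMr // mul1r.
  have := normc_dual_test a0 1 n k w0.
  by rewrite subrr powRr0 mul1r.
have x0 : (0 <= seq_norm +oo%E beta x)%E.
  by apply: le_trans (ub 0%N x); rewrite lee_fin mulr_ge0 ?normc_ge0 // ltW.
have := HM (dual_test a 1 w n) K; rewrite -/x => /(_ (le_lt_trans x1 (ltry _))).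
move=> /(le_trans (ub n _)); rewrite dual_test_sum // => H.
rewrite ler_pdivlMr // -lee_fin; apply: (le_trans H).
rewrite -[X in (_ <= X)%E]mule1.
apply: (@le_trans _ _ (`|M|%:E * seq_norm +oo%E beta x)%E).
  by rewrite lee_wpmul2r // lee_fin ler_norm.
by rewrite lee_wpmul2l // lee_fin.
Qed.

Lemma comp_disk_aut_unbounded (p : \bar R) : (1 <= p)%E -> p <> 2%:E%E ->
  ~ bounded_on_h p beta (comp_op (disk_aut a)).
Proof.
have r0 : 0 < normc a.
  by rewrite lt_def normc_ge0 andbT; apply/eqP => /(@Normc.eq0_normc R).
have r1 : normc a < 1 by apply/unit_diskP.
(* Row estimates are column estimates for the transposed matrix. *)
have row (q M : R) (w : nat -> R) : (forall n, 0 < w n) -> q < 2 ->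
    ~ forall n K, \sum_(k < K) `|c n k| `^ q * w k <= M * w n.
  move=> w0 q2 H.
  apply: (blaschke_coef_no_schur (x := fun n k => `|c k n|) r0 r1 _ _ w0 q2 (fun k m => H k m)) => //.
  by move=> n k; rewrite -normrM mulrC.
case: p => [p|_ _|//].
  rewrite lee_fin => p1 p2 bnd; have p0 : 0 < p by lra.
  have [p2'|p2'|pE] := ltgtP p 2; last by rewrite pE in p2.
    have [M H] := bounded_on_h_columns beta_gt0 aD a0 p0 bnd.
    apply: (blaschke_coef_no_schur (x := fun n k => `|c n k|) r0 r1 _ _ beta_gt0 p2' H) => //.
    by move=> n k; rewrite -normrM.
  (* The conjugate exponent, which lies in [(1, 2)] because [p > 2]. *)
  pose q := p / (p - 1).
  have p10 : 0 < p - 1 by lra.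
  have q1 : 1 < q by rewrite /q ltr_pdivlMr //; lra.
  have q2 : q < 2 by rewrite /q ltr_pdivrMr //; lra.
  have pq : p^-1 + q^-1 = 1 by rewrite /q; field; rewrite !gt_eqF.
  have [M H] := bounded_on_h_rows beta_gt0 aD a0 q1 pq bnd.
  apply: (row q M (fun k => beta k `^ (1 - q))) q2 H => n.
  by rewrite powR_gt0.
move=> /bounded_on_h_rows_pinfty[M H].
by apply: (row 1 M (fun k => (beta k)^-1)) _ H => [n|]; rewrite ?invr_gt0 //; lra.
Qed.

End Unbounded.

Unset Implicit Arguments.

Theorem theorem3p1 (R : realType) (p : \bar R)
    (p_ge1 : (1 <= p)%E) (p_neq2 : p <> 2%:E%E) :
  (forall a : R[i], unit_disk a -> a <> 0 ->
     ~ bounded_on_h p (fun=> 1) (comp_op (disk_aut a))) /\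
  (forall beta : nat -> R, admissible_weight beta ->
   forall a : R[i], unit_disk a -> a <> 0 ->
     ~ bounded_on_h p beta (comp_op (disk_aut a))).
Proof.
split=> [a aD a0|beta [beta_gt0 _] a aD a0]; exact: comp_disk_aut_unbounded.
Qed.
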